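(* Let $(\mathfrak{g},\mathfrak{h},\phi)$ be a morphism Lie algebra and let $(V,W,\psi)$ be a representation of it. If $H^n_{\mathsf{CE}}(\mathfrak{g},V)$, $H^n_{\mathsf{CE}}(\mathfrak{h},W)$ and $H^{n-1}_{\mathsf{CE}}(\mathfrak{g},W_\phi)$ are trivial, then so is $H^n_{\mathsf{mLA}}(\phi,\psi)$.
   Context: All vector spaces and linear maps are over a field $\mathbf{k}$ of characteristic $0$. A morphism Lie algebra is a triple $(\mathfrak{g},\mathfrak{h},\phi)$ of two Lie algebras and a Lie algebra homomorphism $\phi:\mathfrak{g}\to\mathfrak{h}$. A representation of it is a triple $(V,W,\psi)$ with $V$ a representation of $\mathfrak{g}$ (action $\rho_V$), $W$ a representation of $\mathfrak{h}$ (action $\rho_W$) and $\psi:V\to W$ linear with $\psi(\rho_V(x)v)=\rho_W(\phi(x))\psi(v)$ for $x\in\mathfrak{g}$, $v\in V$. $W_\phi$ denotes the representation of $\mathfrak{g}$ on $W$ with action $x\mapsto\rho_W(\phi(x))$. For a representation $(V,\rho)$ of a Lie algebra $\mathfrak{g}$, the Chevalley–Eilenberg complex is $C^n_{\mathsf{CE}}(\mathfrak{g},V)=\mathrm{Hom}(\wedge^n\mathfrak{g},V)$, $n\ge0$, with differential $$(\delta_{\mathsf{CE}}f)(x_1,\ldots,x_{n+1})=\sum_{i=1}^{n+1}(-1)^{i+1}\rho(x_i)f(x_1,\ldots,\widehat{x_i},\ldots,x_{n+1})+\sum_{1\le i<j\le n+1}(-1)^{i+j}f([x_i,x_j],x_1,\ldots,\widehat{x_i},\ldots,\widehat{x_j},\ldots,x_{n+1}),$$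 and cohomology $H^*_{\mathsf{CE}}(\mathfrak{g},V)$. Write $\delta'_{\mathsf{CE}},\delta''_{\mathsf{CE}},\delta'''_{\mathsf{CE}}$ for the differentials of $C^*_{\mathsf{CE}}(\mathfrak{g},V)$, $C^*_{\mathsf{CE}}(\mathfrak{h},W)$, $C^*_{\mathsf{CE}}(\mathfrak{g},W_\phi)$ respectively. Set $C^0_{\mathsf{mLA}}(\phi,\psi)=V$ and, for $n\ge1$, $C^n_{\mathsf{mLA}}(\phi,\psi)=\mathrm{Hom}(\wedge^n\mathfrak{g},V)\oplus\mathrm{Hom}(\wedge^n\mathfrak{h},W)\oplus\mathrm{Hom}(\wedge^{n-1}\mathfrak{g},W)$. Define $\delta_{\mathsf{mLA}}(v)=(\delta'_{\mathsf{CE}}(v),\delta''_{\mathsf{CE}}(\psi(v)),0)$ for $v\in V$, and for $(\theta,\gamma,\eta)\in C^n_{\mathsf{mLA}}(\phi,\psi)$ with $n\ge1$, $\delta_{\mathsf{mLA}}(\theta,\gamma,\eta)=(\delta'_{\mathsf{CE}}(\theta),\ \delta''_{\mathsf{CE}}(\gamma),\ \psi\circ\theta-\gamma\circ\wedge^n\phi-\delta'''_{\mathsf{CE}}(\eta))$. This is a cochain complex, and $H^n_{\mathsf{mLA}}(\phi,\psi)$, $n\ge0$, denotes its $n$-th cohomology (cocycles modulo coboundaries).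
   Formalization: The degree n = 1 is excluded: there the claim fails whenever W is nonzero, since C^0 is V alone while C^1 contains a copy of W; for n = 0 the group H^{-1} is taken to be zero. *)

(* Defs.v *)
From HB Require Import structures.
From mathcomp Require Import all_boot all_order all_algebra perm.
From mathcomp Require Import boolp functions zify.

Set Implicit Arguments.
Unset Strict Implicit.
Unset Printing Implicit Defensive.

Import GRing.Theory.
Local Open Scope ring_scope.

(** * Lie algebras, homomorphisms and representations (any dimension) *)

HB.mixin Record isLieAlgebra (k : fieldType) L of GRing.Lmodule k L := {
  bracket : L -> L -> L;
  bracket_linearl : forall c x y z,
    bracket (c *: x + y) z = c *: bracket x z + bracket y z;
  bracket_linearr : forall c x y z,
    bracket z (c *: x + y) = c *: bracket z x + bracket z y;
  bracket_alt : forall x, bracket x x = 0;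
  bracket_jacobi : forall x y z,
    bracket x (bracket y z) + bracket y (bracket z x)
      + bracket z (bracket x y) = 0
}.

#[short(type="lieAlgType")]
HB.structure Definition LieAlgebra (k : fieldType) :=
  {L of isLieAlgebra k L & GRing.Lmodule k L}.

Record lie_hom (k : fieldType) (g h : lieAlgType k) := LieHom {
  lie_hom_fun :> {linear g -> h};
  lie_hom_bracket : forall x y,
    lie_hom_fun (bracket x y) = bracket (lie_hom_fun x) (lie_hom_fun y)
}.

Record lie_rep (k : fieldType) (g : lieAlgType k) (V : lmodType k) := LieRep {
  act :> g -> V -> V;
  act_linearl : forall c x y v, act (c *: x + y) v = c *: act x v + act y v;
  act_linearr : forall c x v w, act x (c *: v + w) = c *: act x v + act x w;
  act_bracket : forall x y v,
    act (bracket x y) v = act x (act y v) - act y (act x v)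
}.

Section Pullback.
Variables (k : fieldType) (g h : lieAlgType k) (phi : lie_hom g h).
Variables (W : lmodType k) (rhoW : lie_rep h W).

Let a (x : g) (w : W) := rhoW (phi x) w.
Let a_linl c x y v : a (c *: x + y) v = c *: a x v + a y v.
Proof. by rewrite /a linearP act_linearl. Qed.
Let a_linr c x v w : a x (c *: v + w) = c *: a x v + a x w.
Proof. exact: act_linearr. Qed.
Let a_br x y v : a (bracket x y) v = a x (a y v) - a y (a x v).
Proof. by rewrite /a lie_hom_bracket act_bracket. Qed.

Definition rep_pullback : lie_rep g W := LieRep a_linl a_linr a_br.
End Pullback.

Definition morphism_rep (k : fieldType) (g h : lieAlgType k)
    (phi : lie_hom g h) (V W : lmodType k) (rhoV : lie_rep g V)
    (rhoW : lie_rep h W) (psi : {linear V -> W}) : Prop :=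
  forall x v, psi (rhoV x v) = rhoW (phi x) (psi v).

(** * Alternating multilinear maps *)

(* Hom(/\^n g, V), through the universal property of the exterior power:
   maps g^n -> V that are linear in each slot and vanish on every tuple
   with a repeated entry. *)
Definition set_slot (T : Type) n (x : 'I_n -> T) (i : 'I_n) (a : T) :=
  fun j => if j == i then a else x j.

Definition multilinear (k : fieldType) (g V : lmodType k) n
    (f : ('I_n -> g) -> V) : Prop :=
  forall x i c a b, f (set_slot x i (c *: a + b)) =
    c *: f (set_slot x i a) + f (set_slot x i b).

Definition alternating (k : fieldType) (g V : lmodType k) n
    (f : ('I_n -> g) -> V) : Prop :=
  forall x i j, i != j -> x i = x j -> f x = 0.

Section Cochain.
Variables (k : fieldType) (g V : lmodType k) (n : nat).

Definition is_cochain : {pred ('I_n -> g) -> V} :=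
  [pred f | `[< multilinear f /\ alternating f >]].

Lemma is_cochainP f :
  reflect (multilinear f /\ alternating f) (f \in is_cochain).
Proof. exact: asboolP. Qed.

Lemma is_cochain_submod : submod_closed is_cochain.
Proof.
split=> [|c f f' /is_cochainP[fl fa] /is_cochainP[fl' fa']];
  apply/is_cochainP; split.
- by move=> x i c a b; change (0 = c *: 0 + 0 :> V); rewrite scaler0 addr0.
- by [].
- move=> x i e a b.
  have E y : (c *: f + f') y = c *: f y + f' y by [].
  by rewrite !E fl fl' !(scalerDr, scalerA) [c * e]mulrC addrACA.
- move=> x i j ij xij; change (c *: f x + f' x = 0).
  by rewrite (fa _ _ _ ij xij) (fa' _ _ _ ij xij) scaler0 addr0.
Qed.

HB.instance Definition _ := GRing.isSubmodClosed.Build k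
  (('I_n -> g) -> V) is_cochain is_cochain_submod.

Record cochain := Cochain {
  cochain_fun :> ('I_n -> g) -> V; cochainP : cochain_fun \in is_cochain }.

HB.instance Definition _ := [isSub for cochain_fun].
HB.instance Definition _ := [Choice of cochain by <:].
HB.instance Definition _ := [SubChoice_isSubLmodule of cochain by <:].
End Cochain.

(** * The Chevalley-Eilenberg differential *)

Definition tcons (T : Type) n (a : T) (y : 'I_n -> T) : 'I_n.+1 -> T :=
  fun l => if unlift ord0 l is Some l' then y l' else a.

(* For i < j, the increasing enumeration of the indices other than i, j. *)
Definition skip2 m (i j : 'I_m.+2) : 'I_m -> 'I_m.+2 :=
  lift j \o lift (inord i : 'I_m.+1).

Section CEFunction.
Variables (k : fieldType) (g : lieAlgType k) (V : lmodType k).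
Variable rho : lie_rep g V.

(* Indices are numbered from 0, hence the exponents: 1-based (i+1) becomes i,
   and 1-based i+j keeps its parity. *)
Definition CE_action_sum n (f : ('I_n -> g) -> V) (x : 'I_n.+1 -> g) : V :=
  \sum_(i < n.+1) (-1) ^+ i *: rho (x i) (f (x \o lift i)).

Definition CE_bracket_sum n :
    (('I_n -> g) -> V) -> ('I_n.+1 -> g) -> V :=
  match n with
  | 0 => fun _ _ => 0
  | m.+1 => fun f x =>
      \sum_(i < m.+2) \sum_(j < m.+2 | (i < j)%N)
        (-1) ^+ (i + j) *: f (tcons (bracket (x i) (x j)) (x \o skip2 i j))
  end.

Definition CE_fun n (f : ('I_n -> g) -> V) (x : 'I_n.+1 -> g) : V :=
  CE_action_sum f x + CE_bracket_sum f x.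
End CEFunction.

(** Preservation of alternating multilinear maps by the differential *)

Section Slots.
Variables (T : Type).

Lemma set_slot_comp n m (x : 'I_m -> T) (e : 'I_n -> 'I_m) l a :
  injective e -> set_slot x (e l) a \o e = set_slot (x \o e) l a.
Proof. by move=> ei; apply/funext=> j; rewrite /set_slot /= (inj_eq ei). Qed.

Lemma set_slot_avoid n m (x : 'I_m -> T) (e : 'I_n -> 'I_m) s a :
  (forall j, e j != s) -> set_slot x s a \o e = x \o e.
Proof.
by move=> es; apply/funext=> j; rewrite /set_slot /= (negPf (es j)).
Qed.

Lemma set_slot_id n (x : 'I_n -> T) i a : set_slot x i a i = a.
Proof. by rewrite /set_slot eqxx. Qed.

Lemma set_slot_ne n (x : 'I_n -> T) i j a : j != i -> set_slot x i a j = x j.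
Proof. by rewrite /set_slot => /negPf->. Qed.

Lemma set_slot_same n (x : 'I_n -> T) i a : x i = a -> set_slot x i a = x.
Proof. by move=> xi; apply/funext=> j; rewrite /set_slot; case: eqP => // ->. Qed.

Lemma tcons0 n a (y : 'I_n -> T) : tcons a y ord0 = a.
Proof. by rewrite /tcons unlift_none. Qed.

Lemma tconsS n a (y : 'I_n -> T) l : tcons a y (lift ord0 l) = y l.
Proof. by rewrite /tcons liftK. Qed.

Lemma tcons_slot0 n a c (y : 'I_n -> T) :
  tcons a y = set_slot (tcons c y) ord0 a.
Proof.
apply/funext=> j; rewrite /set_slot.
by case: (unliftP ord0 j) => [j'|] ->; rewrite ?tcons0 ?eqxx // !tconsS.
Qed.

Lemma tcons_slotS n c (y : 'I_n -> T) l a :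
  tcons c (set_slot y l a) = set_slot (tcons c y) (lift ord0 l) a.
Proof.
apply/funext=> j; rewrite {2}/set_slot.
case: (unliftP ord0 j) => [j'|] ->; rewrite ?tcons0 //.
by rewrite !tconsS (inj_eq lift_inj) /set_slot.
Qed.
End Slots.

Lemma skip2E m (i j : 'I_m.+2) (l : 'I_m) :
  (i < j)%N -> skip2 i j l = bump j (bump i l) :> nat.
Proof.
move=> ij; have := ltn_ord j => jm.
by rewrite /skip2 /= inordK //; lia.
Qed.

Lemma skip2_inj m (i j : 'I_m.+2) : injective (skip2 i j).
Proof. by move=> a b /lift_inj /lift_inj. Qed.

Lemma skip2_avoid m (i j : 'I_m.+2) l :
  (i < j)%N -> (skip2 i j l != i) && (skip2 i j l != j).
Proof.
move=> ij; apply/andP; split; apply/eqP => /(congr1 (@nat_of_ord _)).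
  by rewrite skip2E // /bump; lia.
by rewrite skip2E // /bump; lia.
Qed.

Lemma skip2_surj m (i j s : 'I_m.+2) :
  (i < j)%N -> s != i -> s != j -> {l | s = skip2 i j l}.
Proof.
move=> ij si sj; case: (unliftP j s) => [s' Es|Es]; last by rewrite Es eqxx in sj.
case: (unliftP (inord i) s') => [l El|El].
  by exists l; rewrite Es El.
have jm := ltn_ord j.
have im : (i < m.+1)%N by lia.
move: si; rewrite Es El -val_eqE /= inordK // /bump.
by rewrite leqNgt ij /= add0n eqxx.
Qed.

Section Multilinear.
Variables (k : fieldType) (g V : lmodType k).

Lemma multilinear_sum n (I : Type) (r : seq I) (P : pred I)
    (F : I -> ('I_n -> g) -> V) :
  (forall i, P i -> multilinear (F i)) ->
  multilinear (fun x => \sum_(i <- r | P i) F i x).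
Proof.
move=> H x s c a b; rewrite scaler_sumr -big_split /=.
by apply: eq_bigr => i Pi; rewrite H.
Qed.

Lemma multilinearZ n (e : k) (f : ('I_n -> g) -> V) :
  multilinear f -> multilinear (fun x => e *: f x).
Proof.
by move=> H x s c a b; rewrite H scalerDr !scalerA [e * c]mulrC.
Qed.

Lemma multilinear0 n (f : ('I_n -> g) -> V) x s :
  multilinear f -> x s = 0 -> f x = 0.
Proof.
move=> fl xs0; have := fl x s (-1) 0 0.
by rewrite scaler0 addr0 (set_slot_same xs0) scaleN1r addNr.
Qed.

Lemma tcons_linear n (f : ('I_n.+1 -> g) -> V) c a b y :
  multilinear f ->
  f (tcons (c *: a + b) y) = c *: f (tcons a y) + f (tcons b y).
Proof.
move=> fl; have e := fl (tcons 0 y) ord0 c a b.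
by rewrite -!tcons_slot0 in e.
Qed.

(* It is enough to test alternation on neighbouring slots. *)
Lemma alternating_adjacent n (f : ('I_n -> g) -> V) :
  multilinear f ->
  (forall x (p q : 'I_n), q = p.+1 :> nat -> x p = x q -> f x = 0) ->
  alternating f.
Proof.
move=> fl fadj.
have fD x s a b : f (set_slot x s (a + b))
    = f (set_slot x s a) + f (set_slot x s b).
  by have := fl x s 1 a b; rewrite !scale1r.
suff main d x (i j : 'I_n) : j = (i + d).+1 :> nat -> x i = x j -> f x = 0.
  move=> x i j ij xij; case: (ltngtP i j) => [lt|lt|/val_inj e].
  - by apply: (main (j - i.+1)%N x i j) => //; lia.
  - by apply: (main (i - j.+1)%N x j i) => //; lia.
  - by rewrite e eqxx in ij.
elim: d x i j => [|d IHd] x i j jE xij.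
  by apply: (fadj x i j) => //; lia.
have jn := ltn_ord j.
have ltl : (j.-1 < n)%N by lia.
pose l := Ordinal ltl.
have lj : l != j by rewrite -val_eqE /=; lia.
have il : i != l by rewrite -val_eqE /=; lia.
have ij : i != j by rewrite -val_eqE /=; lia.
pose t a b := f (set_slot (set_slot x l a) j b).
have t0 a : t a a = 0.
  apply: (fadj _ l j) => /=; first by lia.
  by rewrite set_slot_id set_slot_ne // set_slot_id.
have swap x' a b : set_slot (set_slot x' l a) j b
    = set_slot (set_slot x' j b) l a.
  apply/funext=> o; rewrite /set_slot.
  by case: (eqVneq o j) => // ->; rewrite eq_sym (negPf lj).
have tDl a a' b : t (a + a') b = t a b + t a' b by rewrite /t !swap fD.
have tDr a b b' : t a (b + b') = t a b + t a b' by rewrite /t fD.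
have := t0 (x l + x j).
rewrite tDl !tDr !t0 add0r addr0.
have -> : t (x l) (x j) = f x.
  by rewrite /t (set_slot_same (erefl (x l))) set_slot_same.
have -> : t (x j) (x l) = 0.
  rewrite /t; apply: (IHd _ i l) => /=; first by lia.
  rewrite set_slot_ne // set_slot_ne //.
  by rewrite set_slot_ne // set_slot_id.
by rewrite addr0.
Qed.
End Multilinear.

Section CECochain.
Variables (k : fieldType) (g : lieAlgType k) (V : lmodType k).
Variable rho : lie_rep g V.

Lemma act0r x : rho x 0 = 0.
Proof.
have := act_linearr rho (-1) x 0 0.
by rewrite scaler0 addr0 scaleN1r addNr.
Qed.

Lemma CE_multilinear n (f : ('I_n -> g) -> V) :
  multilinear f -> multilinear (CE_fun rho f).
Proof.
move=> fl.
have ml1 : multilinear (CE_action_sum rho f).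
  apply: multilinear_sum => i _; apply: multilinearZ => x s c a b.
  have [->|si] := eqVneq s i.
    rewrite !set_slot_id !set_slot_avoid ?act_linearl // => j;
    by rewrite eq_sym neq_lift.
  case: (unliftP i s) si => [l ->|->] si; last by rewrite eqxx in si.
  have e : i != lift i l by apply: neq_lift.
  rewrite !set_slot_ne // !set_slot_comp ?fl ?act_linearr //; exact: lift_inj.
have ml2 : multilinear (CE_bracket_sum f).
  case: n f fl {ml1} => [|m] f fl.
    by move=> x s c a b /=; rewrite scaler0 addr0.
  apply: multilinear_sum => i _; apply: multilinear_sum => j ij.
  apply: multilinearZ => x s c a b.
  have ji : j != i by rewrite -val_eqE /=; lia.
  have [->|si] := eqVneq s i.
    rewrite !set_slot_id !(set_slot_ne _ _ ji) !set_slot_avoid; last first.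
    - by move=> l; case/andP: (skip2_avoid l ij).
    - by move=> l; case/andP: (skip2_avoid l ij).
    - by move=> l; case/andP: (skip2_avoid l ij).
    rewrite bracket_linearl tcons_linear //.
  have [->|sj] := eqVneq s j.
    rewrite eq_sym in ji.
    rewrite !set_slot_id !(set_slot_ne _ _ ji) !set_slot_avoid; last first.
    - by move=> l; case/andP: (skip2_avoid l ij).
    - by move=> l; case/andP: (skip2_avoid l ij).
    - by move=> l; case/andP: (skip2_avoid l ij).
    rewrite bracket_linearr tcons_linear //.
  have [l El] := skip2_surj ij si sj.
  have e1 : i != s by rewrite eq_sym.
  have e2 : j != s by rewrite eq_sym.
  rewrite !(set_slot_ne _ _ e1) !(set_slot_ne _ _ e2) El.
  by rewrite !set_slot_comp ?tcons_slotS ?fl //; exact: skip2_inj.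
move=> x s c a b; rewrite /CE_fun ml1 ml2 scalerDr addrACA //.
Qed.

Section Adjacent.
Variables (n : nat) (f : ('I_n -> g) -> V).
Hypotheses (fl : multilinear f) (fa : alternating f).
Variables (x : 'I_n.+1 -> g) (p q : 'I_n.+1).
Hypotheses (pq : q = p.+1 :> nat) (xpq : x p = x q).

Let xE (a b : 'I_n.+1) :
  [|| a == b :> nat, (a == p :> nat) && (b == p.+1 :> nat)
    | (a == p.+1 :> nat) && (b == p :> nat)] -> x a = x b.
Proof.
case/or3P => [/eqP/val_inj->//|/andP[/eqP/val_inj-> bq]|/andP[aq /eqP/val_inj->]].
  by rewrite xpq; congr x; apply/val_inj => /=; rewrite (eqP bq).
by rewrite xpq; congr x; apply/val_inj => /=; rewrite (eqP aq).
Qed.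

Lemma CE_action_sum_adjacent : CE_action_sum rho f x = 0.
Proof.
rewrite /CE_action_sum.
have qp : q != p by rewrite -val_eqE /=; lia.
rewrite (bigD1 p) //= (bigD1 q) //= big1 ?addr0 => [|i /andP[ip iq]].
  have -> : x \o lift q = x \o lift p.
    by apply/funext=> l; apply: xE; rewrite /= pq /bump; lia.
  by rewrite pq exprS mulN1r scaleNr xpq subrr.
rewrite eq_sym in ip; rewrite eq_sym in iq.
case: (unliftP i p) ip => [p' Ep _|->]; last by rewrite eqxx.
case: (unliftP i q) iq => [q' Eq _|->]; last by rewrite eqxx.
rewrite (fa (x := x \o lift i) (i := p') (j := q')) ?act0r ?scaler0 //.
  by apply: contra qp => /eqP e; rewrite Ep Eq e.
by rewrite /= -Ep -Eq.
Qed.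
End Adjacent.

Lemma CE_bracket_sum_adjacent n (f : ('I_n -> g) -> V) x (p q : 'I_n.+1) :
  multilinear f -> alternating f -> q = p.+1 :> nat -> x p = x q ->
  CE_bracket_sum f x = 0.
Proof.
case: n f x p q => [|m] f x p q fl fa pq xpq //=.
have xE (a b : 'I_m.+2) :
    [|| a == b :> nat, (a == p :> nat) && (b == p.+1 :> nat)
      | (a == p.+1 :> nat) && (b == p :> nat)] -> x a = x b.
  case/or3P => [/eqP/val_inj->//|/andP[/eqP/val_inj-> bq]|/andP[aq /eqP/val_inj->]].
    by rewrite xpq; congr x; apply/val_inj => /=; rewrite (eqP bq).
  by rewrite xpq; congr x; apply/val_inj => /=; rewrite (eqP aq).
have qp : q != p by rewrite -val_eqE /=; lia.
rewrite pair_big_dep /=.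
pose P (u : 'I_m.+2 * 'I_m.+2) := (u.1 < u.2)%N.
pose F (u : 'I_m.+2 * 'I_m.+2) := (-1) ^+ (u.1 + u.2) *:
  f (tcons (bracket (x u.1) (x u.2)) (x \o skip2 u.1 u.2)).
pose has a (u : 'I_m.+2 * 'I_m.+2) := (u.1 == a) || (u.2 == a).
pose A u := has p u && ~~ has q u.
pose B u := has q u && ~~ has p u.
rewrite -[LHS]/(\sum_(u | P u) F u).
rewrite (bigID A) /= [X in _ + X](bigID B) /= [X in _ + (_ + X)]big1.
  rewrite addr0.
  pose s (u : 'I_m.+2 * 'I_m.+2) := (tperm p q u.1, tperm p q u.2).
  have sK : involutive s by case=> a b; rewrite /s /= !tpermK.
  have tE a : tperm p q a = (if a == p then p.+1 else if a == q then p else a) :> nat.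
    by case: tpermP => [->|->|/eqP/negPf-> /eqP/negPf->//];
      rewrite ?eqxx ?(negPf qp) // pq.
  rewrite [X in _ + X](reindex_inj (inv_inj sK)) /=.
  rewrite [X in _ + X](eq_bigl (fun u => P u && A u)); last first.
    case=> a b; rewrite /P /A /B /has /s /= -!val_eqE /=.
    rewrite -!/(nat_of_ord (tperm _ _ _)) !tE -!val_eqE /= pq.
    have [?|?] := eqVneq (a : nat) p; have [?|?] := eqVneq (b : nat) p;
      have [?|?] := eqVneq (a : nat) p.+1; have [?|?] := eqVneq (b : nat) p.+1;
      lia.
  rewrite -big_split big1 //= => -[a b] /andP[]; rewrite /P /A /has /F /=.
  rewrite -!val_eqE /= => ab paq.
  have sab : (tperm p q a < tperm p q b)%N.
    rewrite !tE -!val_eqE /= pq.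
    have [?|?] := eqVneq (a : nat) p; have [?|?] := eqVneq (b : nat) p;
    have [?|?] := eqVneq (a : nat) p.+1; have [?|?] := eqVneq (b : nat) p.+1;
    lia.
  have xs c : x (tperm p q c) = x c.
    by case: tpermP => [->|->|].
  rewrite !xs.
  have -> : x \o skip2 (tperm p q a) (tperm p q b) = x \o skip2 a b.
    apply/funext=> l; apply: xE; rewrite !skip2E // !tE -!val_eqE /= pq /bump.
    have [?|?] := eqVneq (a : nat) p; have [?|?] := eqVneq (b : nat) p;
      have [?|?] := eqVneq (a : nat) p.+1; have [?|?] := eqVneq (b : nat) p.+1;
      lia.
  have -> : (-1) ^+ (tperm p q a + tperm p q b) = - (-1) ^+ (a + b) :> k.
    have -> : (tperm p q a + tperm p q b = (a + b).+1)%N.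
      rewrite !tE -!val_eqE /= pq.
      have [?|?] := eqVneq (a : nat) p; have [?|?] := eqVneq (b : nat) p;
        have [?|?] := eqVneq (a : nat) p.+1; have [?|?] := eqVneq (b : nat) p.+1;
        lia.
    by rewrite exprS mulN1r.
  by rewrite scaleNr subrr.
case=> a b; rewrite /P /A /B /has /F /= => /andP[/andP[ab nA] nB].
have [/andP[/eqP-> /eqP->]|nab] := boolP ((a == p) && (b == q)).
  rewrite xpq bracket_alt (multilinear0 (s := ord0)) ?scaler0 //.
  by rewrite tcons0.
have /and4P[pa pb qa qb] : [&& p != a, p != b, q != a & q != b].
  by move: nA nB nab; rewrite -!val_eqE /= pq; lia.
have [l1 E1] := skip2_surj ab pa pb.
have [l2 E2] := skip2_surj ab qa qb.
rewrite (fa _ (lift ord0 l1) (lift ord0 l2)) ?scaler0 // ?tconsS /= -?E1 -?E2 //.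
by rewrite (inj_eq lift_inj); apply: contra qp => /eqP e; rewrite E1 E2 e.
Qed.

Lemma CE_cochain n (f : cochain g V n) : CE_fun rho f \in @is_cochain k g V n.+1.
Proof.
case/is_cochainP: (cochainP f) => fl fa; apply/is_cochainP.
have ml := CE_multilinear fl; split=> //.
apply: alternating_adjacent => // x p q pq xpq.
by rewrite /CE_fun (CE_action_sum_adjacent _ pq) ?(CE_bracket_sum_adjacent _ _ pq) ?addr0.
Qed.
End CECochain.

Section CEDifferential.
Variables (k : fieldType) (g : lieAlgType k) (V : lmodType k).
Variables (rho : lie_rep g V) (n : nat).

Definition CE_diff_fun (f : cochain g V n) : cochain g V n.+1 :=
  Cochain (CE_cochain rho f).

Lemma CE_diff_linear : linear CE_diff_fun.
Proof.
move=> c f f'; apply/val_inj/funext => x /=.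
change (CE_fun rho (c *: (f : _ -> V) + (f' : _ -> V)) x
  = c *: CE_fun rho f x + CE_fun rho f' x).
rewrite /CE_fun scalerDr addrACA; congr (_ + _).
  rewrite scaler_sumr -big_split; apply: eq_bigr => i _ /=.
  by rewrite act_linearr scalerDr !scalerA [_ * c]mulrC.
case: n f f' x => [|m] f f' x /=; first by rewrite scaler0 addr0.
rewrite scaler_sumr -big_split; apply: eq_bigr => i _ /=.
rewrite scaler_sumr -big_split; apply: eq_bigr => j _ /=.
by rewrite scalerDr !scalerA [_ * c]mulrC.
Qed.

HB.instance Definition _ := GRing.isLinear.Build k (cochain g V n)
  (cochain g V n.+1) *:%R CE_diff_fun CE_diff_linear.

Definition CE_diff : {linear cochain g V n -> cochain g V n.+1} := CE_diff_fun.
End CEDifferential.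

(** * Cohomology *)

(* H^n of a sequence C 0 -> C 1 -> ... of linear maps: the cocycles of degree n
   modulo those that are coboundaries, where only 0 is a coboundary in
   degree 0.  For a complex every coboundary is a cocycle. *)
Section Cohomology.
Variables (k : fieldType) (C : nat -> lmodType k).
Variable d : forall n, {linear C n -> C n.+1}.

Definition is_cocycle n : {pred C n} := [pred c | d n c == 0].

Lemma is_cocycle_submod n : submod_closed (@is_cocycle n).
Proof.
split=> [|c x y]; rewrite ?inE ?linear0 // => /eqP dx /eqP dy.
by rewrite linearP dx dy scaler0 addr0.
Qed.

HB.instance Definition _ n := GRing.isSubmodClosed.Build k (C n)
  (@is_cocycle n) (@is_cocycle_submod n).

Record cocycle n := Cocycle {
  cocycle_val :> C n; cocycleP : cocycle_val \in @is_cocycle n }.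

HB.instance Definition _ n := [isSub for @cocycle_val n].
HB.instance Definition _ n := [Choice of cocycle n by <:].
HB.instance Definition _ n := [SubChoice_isSubLmodule of cocycle n by <:].

Definition coboundary n : C n -> Prop :=
  match n with
  | 0 => fun c => c = 0
  | m.+1 => fun c => exists b : C m, c = d m b
  end.

Definition is_coboundary n : {pred cocycle n} :=
  [pred z | `[< coboundary (val z) >]].

Lemma is_coboundary_zmod n : zmod_closed (@is_coboundary n).
Proof.
case: n => [|n]; split=> [|x y]; rewrite ?inE.
- exact/asboolP.
- move=> /asboolP /= x0 /asboolP /= y0; apply/asboolP.
  by rewrite /= x0 y0 subrr.
- by apply/asboolP; exists 0; rewrite !raddf0.
- move=> /asboolP /= [a xa] /asboolP /= [b yb]; apply/asboolP.
  by exists (a - b); rewrite linearB -xa -yb.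
Qed.

HB.instance Definition _ n := GRing.isZmodClosed.Build (cocycle n)
  (@is_coboundary n) (@is_coboundary_zmod n).

Definition cohomology n : zmodType := Quotient.quot (@is_coboundary n).
End Cohomology.

Definition trivial_module (M : zmodType) : Prop := forall c : M, c = 0.

Definition H_CE (k : fieldType) (g : lieAlgType k) (V : lmodType k)
    (rho : lie_rep g V) (n : nat) : zmodType :=
  cohomology (C := fun n => cochain g V n) (fun n => CE_diff rho n) n.

(** * The complex of a morphism Lie algebra *)

Section Functoriality.
Variables (k : fieldType) (n : nat).

Lemma cochain_post_subproof (g V W : lmodType k) (psi : {linear V -> W})
  (f : cochain g V n) : (fun x => psi (f x)) \in @is_cochain k g W n.
Proof.
case/is_cochainP: (cochainP f) => fl fa; apply/is_cochainP; split.
  by move=> x i c a b; rewrite fl linearP.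
by move=> x i j ij xij; rewrite (fa _ _ _ ij xij) linear0.
Qed.

Definition cochain_post (g V W : lmodType k) (psi : {linear V -> W})
  (f : cochain g V n) : cochain g W n := Cochain (cochain_post_subproof psi f).

Lemma cochain_pre_subproof (g h W : lmodType k) (phi : {linear g -> h})
  (f : cochain h W n) : (fun x => f (phi \o x)) \in @is_cochain k g W n.
Proof.
case/is_cochainP: (cochainP f) => fl fa; apply/is_cochainP; split.
  have E x i a : phi \o set_slot x i a = set_slot (phi \o x) i (phi a).
    by apply/funext => j; rewrite /= /set_slot; case: eqP.
  by move=> x i c a b; rewrite !E linearP fl.
by move=> x i j ij xij; rewrite (fa _ _ _ ij) //= xij.
Qed.

Definition cochain_pre (g h W : lmodType k) (phi : {linear g -> h})
  (f : cochain h W n) : cochain g W n := Cochain (cochain_pre_subproof phi f).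
End Functoriality.

(* The identification V = Hom(/\^0 g, V). *)
Section Constant.
Variables (k : fieldType) (g V : lmodType k).

Lemma cochain_cst_subproof (v : V) :
  (fun _ => v) \in @is_cochain k g V 0.
Proof. by apply/is_cochainP; split=> x []. Qed.

Definition cochain_cst (v : V) : cochain g V 0 :=
  Cochain (cochain_cst_subproof v).
End Constant.

Section MLA.
Variables (k : fieldType) (g h : lieAlgType k) (phi : lie_hom g h).
Variables (V W : lmodType k) (rhoV : lie_rep g V) (rhoW : lie_rep h W).
Variable psi : {linear V -> W}.

Definition C_mLA (n : nat) : lmodType k :=
  match n with
  | 0 => V
  | m.+1 => (cochain g V m.+1 * cochain h W m.+1 * cochain g W m)%type
  end.

Definition mLA_diff_fun (n : nat) : C_mLA n -> C_mLA n.+1 :=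
  match n with
  | 0 => fun v =>
      (CE_diff rhoV 0 (cochain_cst g v),
       CE_diff rhoW 0 (cochain_cst h (psi v)), 0)
  | m.+1 => fun '(theta, gamma, eta) =>
      (CE_diff rhoV m.+1 theta, CE_diff rhoW m.+1 gamma,
       cochain_post psi theta - cochain_pre phi gamma
         - CE_diff (rep_pullback phi rhoW) m eta)
  end.

Lemma mLA_diff_linear n : linear (@mLA_diff_fun n).
Proof.
case: n => [|n] c.
  move=> v w /=; congr (_, _, _).
  - rewrite -[RHS]/(c *: CE_diff rhoV 0 _ + CE_diff rhoV 0 _) -linearP.
    by congr (CE_diff _ _ _); apply/val_inj.
  - rewrite -[RHS]/(c *: CE_diff rhoW 0 _ + CE_diff rhoW 0 _) -linearP.
    congr (CE_diff _ _ _); apply/val_inj/funext => x.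
    exact: (linearP psi).
  - by rewrite -[RHS]/(c *: 0 + 0) scaler0 addr0.
move=> [[t y] e] [[t' y'] e']; congr (_, _, _); try exact: linearP.
have G (M : lmodType k) (a a' b b' d d' : M) :
    (c *: a + a') - (c *: b + b') - (c *: d + d')
    = c *: (a - b - d) + (a' - b' - d').
  by rewrite !scalerBr !opprD [c *: a + a' + _]addrACA [LHS]addrACA.
have E1 : cochain_post psi (c *: t + t')
    = c *: cochain_post psi t + cochain_post psi t'.
  by apply/val_inj/funext => x; exact: (linearP psi).
have E2 : cochain_pre phi (c *: y + y')
    = c *: cochain_pre phi y + cochain_pre phi y' by apply/val_inj.
have E3 := linearP (CE_diff (rep_pullback phi rhoW) n) c e e'.
rewrite -[RHS]G -E1 -E2 -E3 //.
Qed.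

HB.instance Definition _ n := GRing.isLinear.Build k (C_mLA n) (C_mLA n.+1)
  *:%R (@mLA_diff_fun n) (@mLA_diff_linear n).

Definition mLA_diff (n : nat) : {linear C_mLA n -> C_mLA n.+1} :=
  @mLA_diff_fun n.

Definition H_mLA (n : nat) : zmodType := cohomology mLA_diff n.
End MLA.

(* Main.v *)
(* An mLA-cocycle (theta, gamma, eta) of degree n + 2 has theta = d a and
   gamma = d b by hypothesis.  Since psi o - and - o phi are cochain maps,
   psi o a - b o phi - eta is a cocycle, hence equals d c for some c, and
   (theta, gamma, eta) is the coboundary of (a, b, c).  In degree 0 a cocycle
   v is already a CE-cocycle, so it vanishes. *)
Require Import Defs.
From mathcomp Require Import all_boot all_order all_algebra.
From mathcomp Require Import boolp.
Import GRing.Theory.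
Local Open Scope ring_scope.

(** Every class has a cocycle representative and vanishes exactly when that is a coboundary. *)
Lemma trivial_cohomologyP (k : fieldType) (C : nat -> lmodType k)
    (d : forall n, {linear C n -> C n.+1}) (n : nat) :
  trivial_module (cohomology d n) <->
  (forall c : C n, d n c = 0 -> coboundary d c).
Proof.
have piE (z : cocycle d n) :
    (\pi_(cohomology d n)%qT z == 0) = (z \in @is_coboundary k C d n).
  by rewrite -[z in RHS]subr0 Quotient.idealrBE raddf0.
split=> [H c /eqP dc | H u].
  have zc : c \in @is_cocycle k C d n by [].
  by have := piE (Cocycle zc); rewrite [X in X == 0]H eqxx => /esym /asboolP.
elim/quotW: u => z; apply/eqP; rewrite piE.
by apply/asboolP; apply: H; apply/eqP; case: z.
Qed.

Lemma comp_tcons (T U : Type) (f : T -> U) n (a : T) (y : 'I_n -> T) :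
  f \o tcons a y = tcons (f a) (f \o y).
Proof. by apply/funext=> l; rewrite /tcons /=; case: unlift. Qed.

(** The action terms agree by definition of the pullback, the bracket terms since [phi] preserves
    brackets. *)
Lemma CE_diff_pre (k : fieldType) (g h : lieAlgType k) (phi : lie_hom g h)
    (W : lmodType k) (rhoW : lie_rep h W) n (f : cochain h W n) :
  CE_diff (rep_pullback phi rhoW) n (cochain_pre phi f)
  = cochain_pre phi (CE_diff rhoW n f).
Proof.
apply/val_inj/funext=> x /=; congr (_ + _).
case: n f x => [|m] f x //=.
apply: eq_bigr => i _; apply: eq_bigr => j _.
by rewrite -lie_hom_bracket comp_tcons.
Qed.

(** Equivariance of [psi] matches the action terms, linearity the bracket terms. *)
Lemma CE_diff_post {k : fieldType} {g h : lieAlgType k} {phi : lie_hom g h}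
    {V W : lmodType k} {rhoV : lie_rep g V} {rhoW : lie_rep h W}
    {psi : {linear V -> W}} n (f : cochain g V n) :
  morphism_rep phi rhoV rhoW psi ->
  CE_diff (rep_pullback phi rhoW) n (cochain_post psi f)
  = cochain_post psi (CE_diff rhoV n f).
Proof.
move=> psi_rep; apply/val_inj/funext=> x /=.
rewrite /CE_fun linearD; congr (_ + _).
  by rewrite linear_sum; apply: eq_bigr => i _; rewrite linearZ psi_rep.
case: n f x => [|m] f x /=; first by rewrite linear0.
rewrite linear_sum; apply: eq_bigr => i _.
by rewrite linear_sum; apply: eq_bigr => j _; rewrite linearZ.
Qed.

(* H^(n-1) is H^(-1) = 0 when n = 0, hence the guard on its hypothesis.
   Degree 1 is excluded because the statement fails there: C^0_mLA is V while
   C^1_mLA contains Hom(/\^0 g, W) = W.  For g = h = k acting on W = k by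
   scaling, phi the identity and V = 0, the groups H^1(g, V), H^1(h, W) and
   H^0(g, W_phi) vanish while H^1_mLA has dimension 1. *)
Theorem proposition3p3 (k : fieldType) (k_char0 : [pchar k] =i pred0)
    (g h : lieAlgType k) (phi : lie_hom g h)
    (V W : lmodType k) (rhoV : lie_rep g V) (rhoW : lie_rep h W)
    (psi : {linear V -> W}) (psi_rep : morphism_rep phi rhoV rhoW psi)
    (n : nat) (n_neq1 : n <> 1%N)
    (HgV : trivial_module (H_CE rhoV n))
    (HhW : trivial_module (H_CE rhoW n))
    (HgW : (0 < n)%N -> trivial_module (H_CE (rep_pullback phi rhoW) n.-1)) :
  trivial_module (H_mLA phi rhoV rhoW psi n).
Proof.
move/trivial_cohomologyP: HgV => {}HgV; move/trivial_cohomologyP: HhW => {}HhW.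
apply/trivial_cohomologyP.
case: n n_neq1 HgV HhW HgW => [|[//|m]] _ HgV HhW HgW.
  move=> v /pair_equal_spec[/pair_equal_spec[dv _] _].
  have v0 : cochain_cst g v = 0 := HgV _ dv.
  (* Evaluating at the empty tuple recovers [v]. *)
  exact: (congr1 (fun f : cochain g V 0 => f (fun=> 0)) v0).
have /trivial_cohomologyP {}HgW := HgW isT.
move=> [[theta gamma] eta].
move=> /pair_equal_spec[/pair_equal_spec[/HgV[a ->] /HhW[b ->]]].
(* Pulls [CE_diff] out of the third component. *)
rewrite -(CE_diff_post _ _ psi_rep) -CE_diff_pre -!linearB => e0.
have [c ec] := HgW _ e0.
exists (a, b, c); congr (_, _, _).
by rewrite -ec opprB addrC subrK.
Qed.
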